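(* Consider the storage model described in the context, and assume: (i) the graph $\mathcal G$ on $\{1,\dots,n\}$ in which $j,k$ are adjacent iff $j,k\in S_i$ for some $i$ is connected; (ii) the linear system \[ \sum_{j=1}^{\kappa_i}\alpha_{ij}=\lambda_i\ (i=1,\dots,\mathcal K),\qquad \sum_{i=1}^{\mathcal K}\sum_{j=1}^{\kappa_i}\alpha_{ij}\,\delta_{\ell,s^i_j}=\tfrac1n\ (\ell=1,\dots,n) \] has a positive solution $(\alpha_{ij})$ (all $\alpha_{ij}>0$). Suppose the embedded shape chain $\{\tilde X^e(m)\}_{m\in\mathbb N}$ is constructed using either the Join the Shortest Queue routing policy or the $\varepsilon$-perturbed strong equilibrium routing policy (built from such a positive solution, with $0<\varepsilon<\min_{i,j}\alpha_{ij}$). Then $\tilde X^e(m)$ is positive recurrent, i.e. $\mathbf E(\tau\mid \tilde X^e(0)=x)<\infty$ for every state $x$, where $\tau=\inf\{m>0:\tilde X^e(m)=0\}$. Moreover, there exists $c>0$ such that for all $0<c'<c$, $\mathbf E(e^{c'\tau}\mid \tilde X^e(0)=x)<\infty$ for all $x$.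
   Context: Storage model: there are $n$ nodes $\{1,\dots,n\}$ and $\mathcal K\ge1$ non-empty neighborhoods $S_1,\dots,S_{\mathcal K}\subset\{1,\dots,n\}$ with $\bigcup_i S_i=\{1,\dots,n\}$; $\kappa_i=|S_i|$ and $S_i=\{s^i_1,\dots,s^i_{\kappa_i}\}$ is a fixed enumeration. Items arrive at $S_i$ as independent Poisson processes with rates $\lambda_i>0$, $\sum_{i=1}^{\mathcal K}\lambda_i=1$. Let $\Lambda_i=\{p\in\mathbb R^{\kappa_i}:p_j\ge0,\sum_j p_j=1\}$. A routing policy is a map $P:\mathbb N^n\to\Lambda_1\times\dots\times\Lambda_{\mathcal K}$, $P(x)=(p^{(1)}(x),\dots,p^{(\mathcal K)}(x))$, with $P(x+c\mathbf 1)=P(x)$ for all integers $c$ (it depends only on the shape); an item arriving at $S_i$ when the configuration is $x$ is stored at node $s^i_j$ with probability $p^{(i)}_j(x)$, independently for each arrival. $X(t)=(X_1(t),\dots,X_n(t))$ is the number of items at each node at time $t$, $M(t)=\frac1n\sum_iX_i(t)$, and the shape is $\tilde X(t)=(X_1(t)-M(t),\dots,X_n(t)-M(t))$. $X^e(m)$, $\tilde X^e(m)$ denote the embedded chains observed at successive arrival moments. For $x\in\mathbb N^n$, $s^i_{j_{\min}}(x)$ is the first node of $S_i$ (in the enumeration) at which $x$ is minimal over $S_i$, and $s^i_{j_{\max}}(x)$ the last node of $S_i$ at which $x$ is maximal over $S_i$. JSQ routing policy: $p^{(i)}_j(x)=1$ if $s^i_j=s^i_{j_{\min}}(x)$ and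 $0$ otherwise. $\varepsilon$-PSERP: given a positive solution $\alpha_{ij}$ of the system above and $0<\varepsilon<\min\alpha_{ij}$, $p^{(i)}_j(x)=(\alpha_{ij}+\varepsilon)/\lambda_i$ if $s^i_j=s^i_{j_{\min}}(x)$, $(\alpha_{ij}-\varepsilon)/\lambda_i$ if $s^i_j=s^i_{j_{\max}}(x)$, $\alpha_{ij}/\lambda_i$ otherwise; if $\kappa_i=1$ then $p^{(i)}_1\equiv1$. $\delta_{\ell,m}$ is the Kronecker delta. *)

(* Defs.v *)
From HB Require Import structures.
From mathcomp Require Import all_boot all_order all_algebra.
From mathcomp Require Import all_classical all_reals all_analysis.
Unset Printing Implicit Defensive.
Import Order.TTheory GRing.Theory Num.Theory.
Local Open Scope ring_scope.

Section StorageModel.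
Variables (R : realType) (n K : nat) (kappa : 'I_K -> nat)
  (s : forall i : 'I_K, 'I_(kappa i) -> 'I_n) (lam : 'I_K -> R).

Definition config := 'I_n -> nat.

Definition policy := config -> forall i : 'I_K, 'I_(kappa i) -> R.

Definition nbhd (i : 'I_K) : {set 'I_n} := (s i) @: [set: 'I_(kappa i)].

Definition adjG : rel 'I_n := fun u v => [exists i : 'I_K, (u \in nbhd i) && (v \in nbhd i)].
Definition G_connected : Prop := forall u v : 'I_n, connect adjG u v.

Definition is_jmin (x : config) (i : 'I_K) (j : 'I_(kappa i)) : bool :=
  [forall k : 'I_(kappa i), (x (s i j) <= x (s i k))%N] &&
  [forall k : 'I_(kappa i), (k < j)%N ==> (x (s i j) < x (s i k))%N].

Definition is_jmax (x : config) (i : 'I_K) (j : 'I_(kappa i)) : bool :=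
  [forall k : 'I_(kappa i), (x (s i k) <= x (s i j))%N] &&
  [forall k : 'I_(kappa i), (j < k)%N ==> (x (s i k) < x (s i j))%N].

Definition JSQ : policy := fun x i j => if is_jmin x i j then 1 else 0.

Definition pos_solution (alpha : forall i : 'I_K, 'I_(kappa i) -> R) : Prop :=
  [/\ forall i j, 0 < alpha i j,
      forall i, \sum_(j < kappa i) alpha i j = lam i &
      forall l : 'I_n, \sum_(i < K) \sum_(j < kappa i)
                          alpha i j * (if s i j == l then 1 else 0) = n%:R^-1].

Definition PSERP (alpha : forall i : 'I_K, 'I_(kappa i) -> R) (eps : R) : policy :=
  fun x i j =>
    if kappa i == 1%N then 1
    else if is_jmin x i j then (alpha i j + eps) / lam i
    else if is_jmax x i j then (alpha i j - eps) / lam i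
    else alpha i j / lam i.

Definition incr (x : config) (l : 'I_n) : config := fun k => (x k + (k == l))%N.

Definition shape (x : config) : 'I_n -> R :=
  fun k => (x k)%:R - (\sum_(l < n) (x l)%:R) / n%:R.

Definition shape_zero (x : config) : bool := [forall k, shape x k == 0].

(* hit P m x = P(tau = m | X^e(0) = x) for m >= 1 (and 0 for m = 0), where
   tau = inf{m > 0 : shape of X^e(m) = 0}; one step of the embedded chain stores
   the arriving item (neighborhood i w.p. lam i) at s i j w.p. P x i j. *)
Fixpoint hit (P : policy) (m : nat) (x : config) : R :=
  match m with
  | 0 => 0
  | m'.+1 => \sum_(i < K) lam i * \sum_(j < kappa i) P x i j *
               (let y := incr x (s i j) in
                if shape_zero y then (if m' == 0%N then 1 else 0) else hit P m' y)
  end.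

(* E( g(tau) | X^e(0) = x ) for a nonnegative g with g(+oo) = +oo:
   sum over finite values of tau, plus +oo times P(tau = +oo). *)
Definition Etau (P : policy) (g : nat -> R) (x : config) : \bar R :=
  (\sum_(1 <= m <oo) ((g m * hit P m x)%:E) +
   +oo * (1 - \sum_(1 <= m <oo) ((hit P m x)%:E)))%E.

End StorageModel.

Arguments policy R {n K} kappa.
Arguments adjG {n K kappa} s.
Arguments G_connected {n K kappa} s.
Arguments JSQ R {n K kappa} s.
Arguments pos_solution {R n K kappa} s lam alpha.
Arguments PSERP {R n K kappa} s lam alpha eps.
Arguments shape {R n} x.
Arguments shape_zero R {n} x.
Arguments hit {R n K kappa} s lam P m x.
Arguments Etau {R n K kappa} s lam P g x.

(* Main.v *)
(** Both policies beat the equilibrium weights [alpha] by a definite amount: for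
    every nondecreasing [f], routing an item of [S_i] lowers the mean of [f] at
    the chosen node, compared with [alpha], by at least [eps] times the
    oscillation of [f] over [S_i]. As [alpha] spreads items uniformly over the
    nodes and the graph is connected, the total gain is at least [eps / n] times
    the global oscillation of [f]. With f(m) = exp (theta m), [theta] small, this
    gives E W(X') <= rho W(X) + b with rho < 1 for the function
    W(x) = sum_k exp (theta * shape_k(x)), whose mean would otherwise be
    preserved to first order in [theta].

    In each step a node of globally minimal content is served with probability
    at least [eps], which lowers the deficit D(x) = sum_k (max x - x_k) by one;
    hence 1 - eta ^ D decreases in mean for small [eta], and
    U = W + A (1 - eta ^ D) satisfies E U(X') <= gam U(X), gam < 1, at every
    nonzero shape. Therefore P(tau > m) <= C(x) gam ^ m. *)
Require Import Defs.
From HB Require Import structures.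
From mathcomp Require Import all_boot all_order all_algebra.
From mathcomp Require Import all_classical all_reals all_analysis.
From mathcomp Require Import ring lra zify.
Import Order.TTheory GRing.Theory Num.Theory.
Import numFieldNormedType.Exports.
Local Open Scope ring_scope.


(** * One-step operator, survival probabilities and the hitting time *)

Section StepOperator.
Variables (R : realType) (n K : nat) (kappa : 'I_K -> nat)
  (s : forall i : 'I_K, 'I_(kappa i) -> 'I_n) (lam : 'I_K -> R)
  (P : policy R (n := n) kappa).
Local Set Implicit Arguments.
Local Unset Strict Implicit.

Definition step (F : config n -> R) (x : config n) : R :=
  \sum_(i < K) lam i * \sum_(j < kappa i) P x i j * F (incr n x (s i j)).

(* [surv m x] is the probability that [tau > m] for the chain started at [x]. *)
Fixpoint surv (m : nat) (x : config n) : R :=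
  if m is m'.+1 then step (fun y => if shape_zero R y then 0 else surv m' y) x
  else 1.

Lemma stepD F G x : step (fun y => F y + G y) x = step F x + step G x.
Proof.
rewrite /step -big_split /=; apply: eq_bigr => i _.
rewrite -mulrDr -big_split /=; congr (_ * _); apply: eq_bigr => j _.
by rewrite mulrDr.
Qed.

Lemma stepZ a F x : step (fun y => a * F y) x = a * step F x.
Proof.
rewrite /step mulr_sumr; apply: eq_bigr => i _.
rewrite [RHS]mulrCA; congr (_ * _); rewrite mulr_sumr; apply: eq_bigr => j _.
by rewrite mulrCA.
Qed.

Lemma stepB F G x : step (fun y => F y - G y) x = step F x - step G x.
Proof.
rewrite -[- step G x]mulN1r -stepZ -stepD; congr (step _ x).
by apply/funext => y; rewrite mulN1r.
Qed.

Hypotheses (lam_ge0 : forall i, 0 <= lam i) (lam_sum : \sum_(i < K) lam i = 1)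
  (P_ge0 : forall x i j, 0 <= P x i j)
  (P_sum : forall x i, \sum_(j < kappa i) P x i j = 1).

Lemma step_cst c x : step (fun=> c) x = c.
Proof.
rewrite /step -[RHS]mul1r -lam_sum mulr_suml; apply: eq_bigr => i _.
by rewrite -mulr_suml P_sum mul1r.
Qed.

Lemma le_step F G x : (forall y, F y <= G y) -> step F x <= step G x.
Proof.
move=> FG; apply: ler_sum => i _; apply: ler_wpM2l => //.
by apply: ler_sum => j _; apply: ler_wpM2l.
Qed.

Lemma step_ge0 F x : (forall y, 0 <= F y) -> 0 <= step F x.
Proof. by move=> F0; rewrite -{1}(step_cst 0 x); exact: le_step. Qed.

Lemma step_ge_term F x i j : (forall y, 0 <= F y) ->
  lam i * P x i j * F (incr n x (s i j)) <= step F x.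
Proof.
move=> F0; rewrite /step (bigD1 i) //= (bigD1 j) //= mulrDr -addrA -mulrA lerDl.
apply: addr_ge0.
  by apply: mulr_ge0 => //; apply: sumr_ge0 => k _; exact: mulr_ge0.
apply: sumr_ge0 => k _; apply: mulr_ge0 => //; apply: sumr_ge0 => l _.
exact: mulr_ge0.
Qed.

Lemma surv_ge0 m x : 0 <= surv m x.
Proof.
elim: m x => [|m IH] x //=; apply: step_ge0 => y.
by case: ifP.
Qed.

(** The event tau = m + 1 is tau > m with tau > m + 1 removed; both sides obey the same one-step
    recursion. *)
Lemma hit_surv m x : hit s lam P m.+1 x = surv m x - surv m.+1 x.
Proof.
elim: m x => [|m IH] x.
  rewrite /= -{2}(step_cst 1 x) -stepB; apply: eq_bigr => i _; congr (_ * _).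
  by apply: eq_bigr => j _; congr (_ * _); case: ifP => _; rewrite ?subr0 ?subrr.
rewrite [surv m.+1 x]/= [surv m.+2 x]/= -stepB.
rewrite [LHS]/=; apply: eq_bigr => i _; congr (_ * _).
apply: eq_bigr => j _; congr (_ * _); case: ifP => _; first by rewrite subr0.
exact: IH.
Qed.

Lemma hit_ge0 m x : 0 <= hit s lam P m x.
Proof.
elim: m x => [|m IH] x //=; apply: (@step_ge0 (fun y =>
  if shape_zero R y then if m == 0%N then 1 else 0 else hit s lam P m y)) => y.
by case: ifP => // _; case: ifP.
Qed.

Lemma sum_hit N x :
  \sum_(1 <= m < N.+1) hit s lam P m x = 1 - surv N x.
Proof.
elim: N => [|N IH]; first by rewrite big_geq //= subrr.
by rewrite big_nat_recr //= -/(hit s lam P N.+1 x) IH hit_surv addrA subrK.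
Qed.

(** Since [surv] tends to 0, tau is almost surely finite: the [+oo] term of [Etau] has factor 0, and
    only the series over finite values remains to be bounded. *)
Lemma Etau_lt_pinfty (g : nat -> R) (M : R) x :
  (surv m x @[m --> \oo] --> (0 : R))%classic ->
  (forall m, 0 <= g m) ->
  (forall N, \sum_(1 <= m < N) g m * hit s lam P m x <= M) ->
  (Etau s lam P g x < +oo)%E.
Proof.
move=> surv0 g0 gM; rewrite /Etau.
have -> : (\sum_(1 <= m <oo) (hit s lam P m x)%:E = 1)%E.
  apply: cvg_lim => //; rewrite -cvg_shiftS /=.
  under eq_fun do rewrite sumEFin sum_hit.
  apply: cvg_EFin; first by exact: nearW.
  rewrite -[X in (_ --> X)%classic]subr0.
  by apply: cvgB => //; exact: cvg_cst.
rewrite subee // mule0 adde0.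
apply: (@le_lt_trans _ _ M%:E); last exact: ltry.
apply: lime_le.
  by apply: is_cvg_nneseries => m _ _; rewrite lee_fin mulr_ge0 ?hit_ge0.
by apply: nearW => N; rewrite sumEFin lee_fin.
Qed.

(** * Moments of the hitting time under a geometric tail *)

Section GeometricTail.
Variables (gam C : R) (x : config n).
Hypotheses (gam_gt0 : 0 < gam) (gam_lt1 : gam < 1) (C_ge0 : 0 <= C)
  (surv_le : forall m, surv m x <= C * gam ^+ m).

Lemma surv_cvg0 : (surv m x @[m --> \oo] --> (0 : R))%classic.
Proof.
apply: (@squeeze_cvgr _ _ _ _ (fun=> 0) (geometric C gam)).
- by apply: nearW => m; rewrite surv_ge0 /=.
- exact: cvg_cst.
- by apply: cvg_geometric; rewrite gtr0_norm.
Qed.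

(** The probability of tau = m + 1 is at most that of tau > m, so the terms are dominated by a
    geometric series of ratio [expR c * gam]. *)
Lemma sum_expR_hit_le c N : 0 < c -> expR c * gam < 1 ->
  \sum_(1 <= m < N) expR (c * m%:R) * hit s lam P m x
    <= expR c * C / (1 - expR c * gam).
Proof.
move=> c0 q1.
have q0 : 0 < expR c * gam by rewrite mulr_gt0 ?expR_gt0.
apply: le_trans (geometric_le_lim N.-1 _ q0 _); last 2 first.
- by rewrite mulr_ge0 ?expR_ge0.
- by rewrite gtr0_norm.
case: N => [|N]; first by rewrite big_geq // /series /= big_geq.
rewrite big_add1 /series; apply: ler_sum => m _.
have -> : c * m.+1%:R = c + m%:R * c by rewrite -natr1; ring.
rewrite hit_surv expRD expRM_natl [X in X <= _]mulrC.
have -> : geometric (expR c * C) (expR c * gam) m =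
  (C * gam ^+ m) * (expR c * expR c ^+ m) by rewrite /= exprMn; ring.
apply: ler_wpM2r; first by rewrite mulr_ge0 ?exprn_ge0 ?expR_ge0.
by apply: le_trans (surv_le m); rewrite gerBl; exact: surv_ge0.
Qed.

Lemma Etau_expR_lt_pinfty c : 0 < c -> expR c * gam < 1 ->
  (Etau s lam P (fun m => expR (c * m%:R)) x < +oo)%E.
Proof.
move=> c0 q1; apply: (Etau_lt_pinfty surv_cvg0) => [m|N].
  exact: expR_ge0.
exact: sum_expR_hit_le.
Qed.

Lemma Etau_nat_lt_pinfty c : 0 < c -> expR c * gam < 1 ->
  (Etau s lam P (fun m => m%:R) x < +oo)%E.
Proof.
move=> c0 q1; apply: (Etau_lt_pinfty surv_cvg0) => [m|N]; first exact: ler0n.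
(* The inequality [c * m <= expR (c * m)] reduces the first moment to the exponential one. *)
apply: (@le_trans _ _ (c^-1 *
  \sum_(1 <= m < N) expR (c * m%:R) * hit s lam P m x)).
  rewrite mulr_sumr; apply: ler_sum => m _.
  rewrite mulrA; apply: ler_wpM2r; first exact: hit_ge0.
  rewrite -ler_pdivrMl ?invr_gt0 // invrK; apply: le_trans (expR_ge1Dx _).
  by rewrite lerDr.
by apply: ler_wpM2l (sum_expR_hit_le N c0 q1); rewrite invr_ge0 ltW.
Qed.

End GeometricTail.

(** Iterating the drift inequality up to the hitting time gives the powers of [gam]. The drift is
    not assumed at a zero shape, where the chain may start, so the first step is taken separately
    and costs [step U x / gam]; the summand 1 settles [m = 0]. *)
Lemma surv_le_lyapunov (U : config n -> R) (gam : R) :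
  0 < gam -> (forall y, 1 <= U y) ->
  (forall y, ~~ shape_zero R y -> step U y <= gam * U y) ->
  forall x m, surv m x <= (1 + step U x / gam) * gam ^+ m.
Proof.
move=> gam0 U1 Udrift.
have U0 y : 0 <= U y by exact: le_trans ler01 (U1 y).
have key m : (forall y, ~~ shape_zero R y -> surv m y <= gam ^+ m * U y) ->
    forall x, surv m.+1 x <= gam ^+ m * step U x.
  move=> IH x; rewrite -stepZ; apply: le_step => y; case: ifP => [_|/negbT/IH //].
  by rewrite mulr_ge0 // exprn_ge0 // ltW.
have bd m : forall y, ~~ shape_zero R y -> surv m y <= gam ^+ m * U y.
  elim: m => [|m IH] y y0; first by rewrite expr0 mul1r.
  apply: le_trans (key m IH y) _.
  by rewrite exprSr -mulrA ler_wpM2l ?Udrift // exprn_ge0 // ltW.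
have EU0 x : 0 <= step U x by exact: step_ge0.
move=> x [|m].
  by rewrite expr0 mulr1 /= lerDl divr_ge0 // ltW.
apply: le_trans (key m (bd m) x) _; rewrite mulrDl mul1r exprS.
have -> : step U x / gam * (gam * gam ^+ m) = gam ^+ m * step U x.
  by field; rewrite gt_eqF.
by rewrite lerDr mulr_ge0 ?exprn_ge0 // ltW.
Qed.

End StepOperator.

(** * The deficit below the fullest node *)

Section Deficit.
Context {n : nat}.
Implicit Types x : config n.

(** This is n times the largest shape coordinate (see [shape_argmax]); being a natural number, it
    can serve as an exponent. *)
Definition deficit x : nat := \sum_k (\max_l x l - x k)%N.

(** The strictly larger entry at [u] keeps the maximum unchanged, so only the summand of [v]
    moves. *)
Lemma deficit_incr_min x v u : (forall k, (x v <= x k)%N) -> (x v < x u)%N ->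
  (deficit (incr n x v)).+1 = deficit x.
Proof.
move=> vmin vu; rewrite /deficit.
have -> : (\max_l incr n x v l = \max_l x l)%N.
  apply/eqP; rewrite eqn_leq; apply/andP; split; apply/bigmax_leqP => k _.
    rewrite /incr; case: eqP => [->|_]; rewrite ?addn0 ?addn1 ?leq_bigmax //.
    exact: leq_trans vu (leq_bigmax u).
  by apply: leq_trans (leq_bigmax k); rewrite /incr leq_addr.
have vM : (x v < \max_l x l)%N by exact: leq_trans vu (leq_bigmax u).
rewrite (bigD1 v) // [in RHS](bigD1 v) //= /incr eqxx addn1.
rewrite -addSn; congr addn; first by rewrite subnS prednK ?subn_gt0.
by apply: eq_bigr => k /negbTE ->; rewrite addn0.
Qed.

Lemma exists_argmax x : (0 < n)%N -> exists u, forall k, (x k <= x u)%N.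
Proof.
move=> n0; case: (arg_maxnP x (isT : predT (Ordinal n0))) => u _ umax.
by exists u => k; exact: umax.
Qed.

Lemma exists_argmin x : (0 < n)%N -> exists v, forall k, (x v <= x k)%N.
Proof.
move=> n0; case: (arg_minnP x (isT : predT (Ordinal n0))) => v _ vmin.
by exists v => k; exact: vmin.
Qed.

End Deficit.

(** * Shapes and the exponential Lyapunov function *)

Section Shape.
Context {R : realType} {n : nat}.
Hypothesis n_gt0 : (0 < n)%N.
Implicit Types x : config n.

Let n_neq0 : n%:R != 0 :> R.
Proof. by rewrite pnatr_eq0 -lt0n. Qed.

Lemma shape_zero_cst x : (forall u v, x u = x v) -> shape_zero R x.
Proof.
move=> xc; apply/forallP => k; rewrite /Defs.shape (eq_bigr (fun=> (x k)%:R : R)).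
  by rewrite sumr_const card_ord -[(x k)%:R *+ n]mulr_natr mulfK // subrr.
by move=> l _; rewrite (xc l k).
Qed.

Lemma shape_nonzero_lt x v : ~~ shape_zero R x -> (forall k, (x v <= x k)%N) ->
  exists u, (x v < x u)%N.
Proof.
move=> x0 vmin; apply/existsP; apply: contraR x0 => /existsPn vmax.
have xE k : x k = x v.
  by apply/eqP; rewrite eqn_leq vmin andbT leqNgt vmax.
by apply: shape_zero_cst => u w; rewrite !xE.
Qed.

Lemma shape_incr x l k :
  Defs.shape (incr n x l) k = Defs.shape x k + (k == l)%:R - n%:R^-1 :> R.
Proof.
rewrite /Defs.shape /incr natrD.
under eq_bigr do rewrite natrD.
rewrite big_split /= (_ : \sum_(i < n) (i == l)%:R = 1) ?mulrDl ?mul1r; last first.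
  by rewrite (bigD1 l) //= eqxx big1 ?addr0 // => i /negbTE ->.
by rewrite opprD !addrA; congr (_ - _); rewrite addrAC.
Qed.

Lemma shape_argmax x u : (forall k, (x k <= x u)%N) ->
  Defs.shape x u * n%:R = (deficit x)%:R :> R.
Proof.
move=> umax; rewrite /Defs.shape mulrBl divfK // /deficit.
have -> : (\max_l x l = x u)%N.
  apply/eqP; rewrite eqn_leq leq_bigmax andbT.
  by apply/bigmax_leqP => k _; exact: umax.
rewrite natr_sum; under [RHS]eq_bigr => k _ do rewrite (natrB _ (umax k)).
by rewrite sumrB sumr_const card_ord mulr_natr.
Qed.

Lemma shape_argmin_le0 x v : (forall k, (x v <= x k)%N) -> Defs.shape x v <= 0 :> R.
Proof.
move=> vmin; rewrite /Defs.shape subr_le0 ler_pdivlMr ?ltr0n // mulr_natr.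
by rewrite -[n in _ *+ n]card_ord -sumr_const ler_sum // => k _; rewrite ler_nat.
Qed.

Definition expW (theta : R) x : R := \sum_k expR (theta * Defs.shape x k).

(** The rise of the mean multiplies every term by the same factor, and node [l] alone gains an extra
    [expR theta]. *)
Lemma expW_incr theta x l : expW theta (incr n x l) =
  expR (- (theta / n%:R)) *
    (expW theta x + (expR theta - 1) * expR (theta * Defs.shape x l)).
Proof.
rewrite /expW mulrDr mulr_sumr (bigD1 l) //= [in RHS](bigD1 l) //=.
under eq_bigr => k /negbTE kl.
  rewrite shape_incr kl addr0 mulrBr addrC expRD; over.
rewrite shape_incr eqxx.
have -> : theta * (Defs.shape x l + true%:R - n%:R^-1) =
  theta * Defs.shape x l + theta + - (theta / n%:R) by rewrite mulr1n; ring.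
rewrite !expRD; ring.
Qed.

Lemma expW_le theta x u : 0 <= theta -> (forall k, (x k <= x u)%N) ->
  expW theta x <= n%:R * expR (theta * Defs.shape x u).
Proof.
move=> t0 umax; rewrite mulr_natl -[n in _ *+ n]card_ord -sumr_const ler_sum //.
by move=> k _; rewrite ler_expR ler_wpM2l // /Defs.shape lerD2r ler_nat.
Qed.

(** Only the term of the fullest node is kept; this turns a bound on [expW] into a bound on the
    deficit. *)
Lemma expW_ge theta x u : (forall k, (x k <= x u)%N) ->
  1 + theta * (deficit x)%:R / n%:R <= expW theta x.
Proof.
move=> /shape_argmax dE; rewrite -dE mulrA mulfK //.
apply: le_trans (expR_ge1Dx _) _; rewrite /expW (bigD1 u) //= lerDl.
by apply: sumr_ge0 => k _; exact: expR_ge0.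
Qed.

Lemma expW_ge1 theta x : 0 <= theta -> 1 <= expW theta x.
Proof.
move=> t0; have [u umax] := exists_argmax x n_gt0.
by apply: le_trans (expW_ge theta _ _ umax); rewrite lerDl divr_ge0 ?mulr_ge0.
Qed.

End Shape.

(** * The two policies compared with the equilibrium weights *)

Section Policies.
Variables (R : realType) (n K : nat) (kappa : 'I_K -> nat)
  (s : forall i : 'I_K, 'I_(kappa i) -> 'I_n) (lam : 'I_K -> R).
Local Set Implicit Arguments.
Local Unset Strict Implicit.
Implicit Types (x : config n) (P : policy R (n := n) kappa)
  (alpha : forall i : 'I_K, 'I_(kappa i) -> R).

Local Notation jmin := (is_jmin n K kappa s).
Local Notation jmax := (is_jmax n K kappa s).

(* The lexicographic order on (content, index) is encoded in a single number. *)
Lemma jmin_ex x i : (0 < kappa i)%N -> exists j, jmin x i j.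
Proof.
move=> k0.
case: (arg_minnP (fun j : 'I_(kappa i) => x (s i j) * kappa i + j)%N
  (isT : predT (Ordinal k0))) => j _ jmin_.
exists j; apply/andP; split; apply/forallP => k; last apply/implyP => kj;
  have /= := jmin_ k isT; have := ltn_ord j; have := ltn_ord k; nia.
Qed.

Lemma jmax_ex x i : (0 < kappa i)%N -> exists j, jmax x i j.
Proof.
move=> k0.
case: (arg_maxnP (fun j : 'I_(kappa i) => x (s i j) * kappa i + j)%N
  (isT : predT (Ordinal k0))) => j _ jmax_.
exists j; apply/andP; split; apply/forallP => k; last apply/implyP => kj;
  have /= := jmax_ k isT; have := ltn_ord j; have := ltn_ord k; nia.
Qed.

Lemma jminP x i : (0 < kappa i)%N -> exists j0,
  (forall k, (x (s i j0) <= x (s i k))%N) /\ forall j, jmin x i j = (j == j0).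
Proof.
move=> /(jmin_ex x)[j0 m0]; have [/forallP le0 /forallP lt0] := andP m0.
exists j0; split=> // j; apply/idP/eqP => [/andP[/forallP le1 /forallP lt1]|-> //].
case: (ltngtP j0 j) => [h|h|/ord_inj //].
- by have := implyP (lt1 _) h; rewrite ltnNge le0.
- by have := implyP (lt0 _) h; rewrite ltnNge le1.
Qed.

Lemma jmaxP x i : (0 < kappa i)%N -> exists j1,
  (forall k, (x (s i k) <= x (s i j1))%N) /\ forall j, jmax x i j = (j == j1).
Proof.
move=> /(jmax_ex x)[j0 m0]; have [/forallP le0 /forallP lt0] := andP m0.
exists j0; split=> // j; apply/idP/eqP => [/andP[/forallP le1 /forallP lt1]|-> //].
case: (ltngtP j0 j) => [h|h|/ord_inj //].
- by have := implyP (lt0 _) h; rewrite ltnNge le1.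
- by have := implyP (lt1 _) h; rewrite ltnNge le0.
Qed.

(** The first minimum can have no index before it that is no larger, the last maximum none after it
    that is no smaller. This rules out a clash of the [+ eps] and [- eps] branches of [PSERP] when
    [kappa i] is not 1. *)
Lemma jmin_jmax_kappa1 x i j : jmin x i j -> jmax x i j -> kappa i = 1%N.
Proof.
move=> /andP[/forallP le0 /forallP lt0] /andP[/forallP le1 /forallP lt1].
have uniq_j k : k = j.
  case: (ltngtP j k) => [h|h|/ord_inj //].
  - by have := implyP (lt1 _) h; rewrite ltnNge le0.
  - by have := implyP (lt0 _) h; rewrite ltnNge le1.
rewrite -(card_ord (kappa i)) -(card1 j); apply: eq_card => k.
by rewrite !inE (uniq_j k) eqxx.
Qed.

(* The third clause bounds from below the gain over routing with the weights
   [alpha] by [eps] times the oscillation of [f] over the neighbourhood. *)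
Definition balanced alpha (eps : R) P :=
  [/\ forall x i j, 0 <= P x i j,
      forall x i, \sum_(j < kappa i) P x i j = 1,
      forall x i (f : nat -> R), {homo f : a b / (a <= b)%N >-> a <= b} ->
        forall j k, eps * (f (x (s i j)) - f (x (s i k))) <=
          \sum_(l < kappa i) alpha i l * f (x (s i l)) -
            lam i * \sum_(l < kappa i) P x i l * f (x (s i l)) &
      forall x i, exists2 j, forall k, (x (s i j) <= x (s i k))%N &
        eps <= lam i * P x i j].

Hypotheses (kappa_gt0 : forall i, (0 < kappa i)%N) (lam_gt0 : forall i, 0 < lam i).

Lemma alpha_le_lam alpha i j : pos_solution s lam alpha -> alpha i j <= lam i.
Proof.
move=> [a0 asum _]; rewrite -asum (bigD1 j) //= lerDl.
by apply: sumr_ge0 => k _; exact: ltW.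
Qed.

(** All mass sits at a minimizer [j0], so the gain sums [alpha i l] times the excess of [f] over its
    value at [j0]. The terms are nonnegative, and the one at [j] suffices because
    [eps < alpha i j]. *)
Lemma JSQ_balanced alpha eps : pos_solution s lam alpha -> 0 < eps ->
  (forall i j, eps < alpha i j) -> balanced alpha eps (JSQ R s).
Proof.
move=> sol e0 ea; have [a0 asum _] := sol.
have JE x i j0 : (forall j, jmin x i j = (j == j0)) -> forall f : 'I_(kappa i) -> R,
    \sum_(l < kappa i) JSQ R s x i l * f l = f j0.
  move=> mE f; rewrite (bigD1 j0) //= /JSQ mE eqxx mul1r big1 ?addr0 // => j.
  by rewrite mE => /negbTE ->; rewrite mul0r.
split=> [x i j|x i|x i f fmono j k|x i].
- by rewrite /JSQ; case: ifP.
- have [j0 [_ mE]] := jminP x (kappa_gt0 i).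
  by rewrite -[RHS](JE _ _ _ mE (fun=> 1)); apply: eq_bigr => j _; rewrite mulr1.
- have [j0 [le0 mE]] := jminP x (kappa_gt0 i).
  rewrite (JE _ _ _ mE (fun l => f (x (s i l)))) -asum mulr_suml -sumrB.
  have f0 l : f (x (s i j0)) <= f (x (s i l)) by exact: fmono.
  rewrite (bigD1 j) //=.
  apply: (@le_trans _ _ (alpha i j * (f (x (s i j)) - f (x (s i j0))))).
    apply: (@le_trans _ _ (eps * (f (x (s i j)) - f (x (s i j0))))).
      by rewrite ler_pM2l // lerD2l lerN2.
    by apply: ler_wpM2r; rewrite ?subr_ge0 // ltW.
  rewrite -mulrBr lerDl; apply: sumr_ge0 => l _; rewrite -mulrBr.
  by rewrite mulr_ge0 ?subr_ge0 // ltW.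
- have [j0 [le0 mE]] := jminP x (kappa_gt0 i); exists j0 => //.
  rewrite /JSQ mE eqxx mulr1; apply: le_trans (alpha_le_lam j0 sol).
  exact: ltW.
Qed.

(** One formula covers every case: for [kappa i = 1] the indices [j0] and [j1] coincide and the
    perturbations cancel. *)
Lemma PSERP_weights alpha eps x i : pos_solution s lam alpha ->
  exists j0 j1, [/\ forall k, (x (s i j0) <= x (s i k))%N,
    forall k, (x (s i k) <= x (s i j1))%N &
    forall j, lam i * PSERP s lam alpha eps x i j =
      alpha i j + eps * (j == j0)%:R - eps * (j == j1)%:R].
Proof.
move=> [a0 asum _]; have lam0 : lam i != 0 by rewrite gt_eqF.
have [j0 [le0 mE]] := jminP x (kappa_gt0 i).
have [j1 [le1 ME]] := jmaxP x (kappa_gt0 i).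
exists j0, j1; split=> // j; rewrite /PSERP; case: eqP => [k1|k1].
  have cst k : k = j0.
    by apply: ord_inj; have := ltn_ord k; have := ltn_ord j0; lia.
  rewrite (cst j) (cst j1) addrK mulr1 -asum (bigD1 j0) //= big1 ?addr0 //.
  by move=> k; rewrite (cst k) eqxx.
rewrite mE ME; case: eqP => [->|_]; last first.
  by case: eqP => _; rewrite ?mulr1 ?mulr0 ?addr0 ?subr0 mulrC divfK.
have -> : (j0 == j1) = false.
  by apply/negP => /eqP j01; apply: k1; apply: (@jmin_jmax_kappa1 x i j0);
    rewrite ?mE ?ME j01 eqxx.
by rewrite mulr1 mulr0 subr0 mulrC divfK.
Qed.

(** The perturbation moves weight [eps] from a maximizer to a minimizer, so the gain is exactly
    [eps] times the oscillation of [f] over the neighborhood. *)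
Lemma PSERP_balanced alpha eps : pos_solution s lam alpha -> 0 < eps ->
  (forall i j, eps < alpha i j) -> balanced alpha eps (PSERP s lam alpha eps).
Proof.
move=> sol e0 ea; have [a0 asum _] := sol.
have sum_delta i (j0 : 'I_(kappa i)) (f : 'I_(kappa i) -> R) :
    \sum_l (eps * (l == j0)%:R) * f l = eps * f j0.
  rewrite (bigD1 j0) //= eqxx mulr1 big1 ?addr0 // => j /negbTE ->.
  by rewrite mulr0 mul0r.
have sumE x i j0 j1 (f : 'I_(kappa i) -> R) :
    (forall j, lam i * PSERP s lam alpha eps x i j =
      alpha i j + eps * (j == j0)%:R - eps * (j == j1)%:R) ->
    lam i * \sum_l PSERP s lam alpha eps x i l * f l =
      \sum_l alpha i l * f l + eps * f j0 - eps * f j1.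
  move=> PE; rewrite -[in RHS](sum_delta i j0) -[in RHS](sum_delta i j1).
  rewrite -big_split -sumrB /= mulr_sumr; apply: eq_bigr => l _.
  by rewrite mulrA PE mulrBl mulrDl.
split=> [x i j|x i|x i f fmono j k|x i];
  have [j0 [j1 [le0 le1 PE]]] := PSERP_weights eps x i sol.
- rewrite -(pmulr_rge0 _ (lam_gt0 i)) PE; have := ea i j.
  by case: eqP => _; case: eqP => _ /=; rewrite ?mulr1n ?mulr0n ?mulr1 ?mulr0; lra.
- apply: (mulfI (lt0r_neq0 (lam_gt0 i))); rewrite mulr1.
  have sum1 (F : 'I_(kappa i) -> R) : \sum_l F l * 1 = \sum_l F l.
    by apply: eq_bigr => l _; rewrite mulr1.
  by have := sumE x i j0 j1 (fun=> 1) PE; rewrite !sum1 asum addrK.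
- rewrite (sumE _ _ _ _ (fun l => f (x (s i l))) PE).
  have := fmono _ _ (le0 k); have := fmono _ _ (le1 j); nra.
- exists j0 => //; rewrite PE eqxx mulr1; have := ea i j0.
  by case: eqP => _; rewrite ?mulr1n ?mulr0n ?mulr1 ?mulr0; lra.
Qed.

(** Join the Shortest Queue comes without an [eps]; one is built from the sum of all inverses, which
    dominates each of them. *)
Lemma pos_lower_bound alpha : (forall i j, 0 < alpha i j) ->
  exists2 eps, 0 < eps & forall i j, eps < alpha i j.
Proof.
move=> a0; pose I := {i : 'I_K & 'I_(kappa i)}.
have [B Blb] : exists B : R, forall t : I, (alpha (tag t) (tagged t))^-1 <= B.
  exists (\sum_(t : I) (alpha (tag t) (tagged t))^-1) => t.
  rewrite (bigD1 t) //= lerDl sumr_ge0 // => u _.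
  by rewrite invr_ge0 ltW.
have B0 : 0 < 1 + `|B| by rewrite ltr_pwDl.
exists (1 + `|B|)^-1 => [|i j]; first by rewrite invr_gt0.
rewrite -[alpha i j]invrK ltf_pV2 ?posrE ?invr_gt0 //.
have := Blb (Tagged _ j) => /= aB; apply: le_lt_trans aB _.
by have := ler_norm B; lra.
Qed.

End Policies.

(** * Drift inequalities and the Lyapunov function *)

Section Drift.
Variables (R : realType) (n K : nat) (kappa : 'I_K -> nat)
  (s : forall i : 'I_K, 'I_(kappa i) -> 'I_n) (lam : 'I_K -> R)
  (alpha : forall i : 'I_K, 'I_(kappa i) -> R) (eps : R)
  (P : policy R (n := n) kappa).
Hypotheses (n_gt0 : (0 < n)%N) (cover : forall l : 'I_n, exists i j, s i j = l)
  (conn : G_connected s) (lam_gt0 : forall i, 0 < lam i)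
  (lam_sum : \sum_(i < K) lam i = 1) (sol : pos_solution s lam alpha)
  (eps_gt0 : 0 < eps) (eps_lt1 : eps < 1) (bal : balanced s lam alpha eps P).
Local Set Implicit Arguments.
Local Unset Strict Implicit.
Implicit Types x : config n.

Local Notation step := (step s lam P).

Let lam_ge0 i : 0 <= lam i. Proof. exact: ltW. Qed.
Let P_ge0 x i j : 0 <= P x i j. Proof. by case: bal. Qed.
Let P_sum x i : \sum_(j < kappa i) P x i j = 1. Proof. by case: bal. Qed.
Let N_gt0 : 0 < n%:R :> R. Proof. by rewrite ltr0n. Qed.

(** This is the second family of equations of the linear system, tested against [g]. *)
Lemma sum_alpha (g : 'I_n -> R) :
  \sum_(i < K) \sum_(j < kappa i) alpha i j * g (s i j) = n%:R^-1 * \sum_l g l.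
Proof.
have [_ _ node] := sol; rewrite mulr_sumr.
under [RHS]eq_bigr => l _ do rewrite -(node l) mulr_suml.
rewrite exchange_big; apply: eq_bigr => i _ /=.
under [RHS]eq_bigr => l _ do rewrite mulr_suml.
rewrite exchange_big; apply: eq_bigr => j _ /=.
rewrite (bigD1 (s i j)) //= eqxx mulr1 big1 ?addr0 // => l.
by rewrite eq_sym => /negbTE ->; rewrite mulr0 mul0r.
Qed.

(* Along a path of the graph, each edge lies in a single neighbourhood, whose
   spread of values of [f] is paid for by the gain of that neighbourhood. *)
Lemma spread_le x (f : nat -> R) u v :
  {homo f : a b / (a <= b)%N >-> a <= b} ->
  eps * (f (x u) - f (x v)) <= n%:R * (n%:R^-1 * \sum_l f (x l) -
    \sum_(i < K) lam i * \sum_(j < kappa i) P x i j * f (x (s i j))).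
Proof.
move=> fmono; have [_ _ gain _] := bal.
rewrite -(sum_alpha (fun l => f (x l))) -sumrB.
set D := \sum_(i < K) _.
(* The gain clause is used with two equal indices; an empty neighborhood would contradict
   [P_sum]. *)
have gain_ge0 i : 0 <= \sum_(j < kappa i) alpha i j * f (x (s i j)) -
    lam i * \sum_(j < kappa i) P x i j * f (x (s i j)).
  have [E|k_gt0] := posnP (kappa i).
    have no (F : 'I_(kappa i) -> R) : \sum_j F j = 0.
      by rewrite big1 // => j; have := ltn_ord j; lia.
    by have := P_sum x i; rewrite no => /eqP; rewrite eq_sym oner_eq0.
  by have := gain x i f fmono (Ordinal k_gt0) (Ordinal k_gt0); rewrite subrr mulr0.
have D_ge0 : 0 <= D by apply: sumr_ge0.
have edge a b : adjG s a b -> eps * (f (x a) - f (x b)) <= D.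
  case/existsP => i /andP[/imsetP[j _ ->] /imsetP[k _ ->]].
  apply: le_trans (gain x i f fmono j k) _.
  by rewrite /D (bigD1 i) //= lerDl; apply: sumr_ge0 => l _; exact: gain_ge0.
have walk p : forall a, path (adjG s) a p ->
    eps * (f (x a) - f (x (last a p))) <= (size p)%:R * D.
  elim: p => [|b p IH] a /=; first by rewrite subrr mulr0 mul0r.
  case/andP => /edge ab /IH bp; rewrite -natr1 mulrDl mul1r.
  by have := lerD bp ab; apply: le_trans; rewrite -mulrDr; apply: ler_wpM2l;
    [exact: ltW | lra].
(* A path without repeated vertices has fewer than n edges. *)
have /connectP[p0 /shortenP[p up uniq_p _] ->] := conn u v.
apply: le_trans (walk p u up) _; apply: ler_wpM2r => //; rewrite ler_nat.
have := max_card (mem (u :: p)); rewrite (card_uniqP uniq_p) card_ord /=.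
exact: ltnW.
Qed.

Lemma step_expW theta x : step (expW theta) x =
  expR (- (theta / n%:R)) * (expW theta x + (expR theta - 1) *
    \sum_(i < K) lam i * \sum_(j < kappa i)
      P x i j * expR (theta * Defs.shape x (s i j))).
Proof.
set a := expR (- _); set q := _ - 1; set W := expW theta x.
transitivity (\sum_(i < K) (a * W * lam i + a * q * (lam i *
    \sum_(j < kappa i) P x i j * expR (theta * Defs.shape x (s i j))))).
  apply: eq_bigr => i _.
  rewrite (eq_bigr (fun j => a * W * P x i j +
    a * q * (P x i j * expR (theta * Defs.shape x (s i j))))); last first.
    by move=> j _; rewrite expW_incr // -/a -/q -/W; ring.
  by rewrite big_split /= -!mulr_sumr P_sum; ring.
by rewrite big_split /= -!mulr_sumr lam_sum; ring.
Qed.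

(** By [spread_le] between a fullest and an emptiest node, the mean exponential at the chosen node
    is at most (1 - e) W / N + e with e = eps / N. Inserting this in [step_expW] yields [rho] and
    [b]. *)
Lemma expW_drift : exists theta rho b : R,
  [/\ 0 < theta, 0 <= rho, rho < 1, 0 <= b &
      forall x, step (expW theta) x <= rho * expW theta x + b].
Proof.
set N : R := n%:R; have N_ge1 : 1 <= N by rewrite ler1n.
have N0 : N != 0 by rewrite gt_eqF.
pose e := eps / N.
have e_gt0 : 0 < e by exact: divr_gt0.
have e_lt1 : e < 1 by rewrite ltr_pdivrMr // mul1r (lt_le_trans eps_lt1).
(* Half of [e] is small enough to give [q * (1 - e) < theta], from which [rho < 1] follows. *)
pose theta := e / 2; pose a := expR (- (theta / N)); pose q := expR theta - 1.
have t_gt0 : 0 < theta by rewrite /theta; lra.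
have a_gt0 : 0 < a by exact: expR_gt0.
have q_gt0 : 0 < q by rewrite subr_gt0 expR_gt1.
exists theta, (a * (1 + q * (1 - e) / N)), (a * q * e).
have qe : q * (1 - e) < theta.
  have E1 : expR theta * (1 - theta) <= 1.
    rewrite -[leRHS](expRxMexpNx_1 theta) ler_pM2l ?expR_gt0 //.
    exact: expR_ge1Dx.
  have : q * (1 - theta) <= theta by rewrite /q; lra.
  have -> : 1 - e = (1 - theta) - theta by rewrite /theta; lra.
  by rewrite mulrBr; have := mulr_gt0 q_gt0 t_gt0; lra.
split=> //.
- rewrite mulr_ge0 ?(ltW a_gt0) // addr_ge0 // divr_ge0 ?(ltW N_gt0) //.
  by rewrite mulr_ge0 ?(ltW q_gt0) // subr_ge0 ltW.
(* The left side is below 1 + theta / N, hence below [expR (theta / N)], which is the inverse of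
   [a]. *)
- have : 1 + q * (1 - e) / N < expR (theta / N).
    apply: lt_le_trans (expR_ge1Dx _); rewrite ltrD2l ltr_pM2r // ?invr_gt0 //.
  by rewrite -(ltr_pM2l a_gt0) /a mulrC [X in _ < X]mulrC expRxMexpNx_1 mulrC.
- exact: ltW (mulr_gt0 (mulr_gt0 a_gt0 q_gt0) e_gt0).
move=> x; rewrite step_expW -/N -/a -/q.
have [u umax] := exists_argmax x n_gt0.
have [v vmin] := exists_argmin x n_gt0.
(* With the mean frozen at that of [x], [f (x k)] is the term of [expW theta x] at node [k]. *)
pose f (m : nat) : R := expR (theta * (m%:R - (\sum_(l < n) (x l)%:R) / N)).
have fmono : {homo f : b c / (b <= c)%N >-> b <= c}.
  move=> b c bc; rewrite ler_expR ler_wpM2l ?(ltW t_gt0) // lerD2r ler_nat //.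
have := @spread_le x f u v fmono.
rewrite -/N -[\sum_l f (x l)]/(expW theta x).
set S := \sum_(i < K) _; rewrite -/S => spr.
have fu : expW theta x / N <= f (x u).
  by rewrite ler_pdivrMr // mulrC; apply: expW_le => //; exact: ltW.
have fv : f (x v) <= 1.
  have sv := shape_argmin_le0 (R := R) n_gt0 x v vmin.
  by rewrite -[leRHS]expR0 ler_expR pmulr_rle0.
(* The largest term is at least the average W / N, and the term of an emptiest node is at most 1. *)
have SW : S <= expW theta x / N - e * (expW theta x / N - 1).
  have : e * (f (x u) - f (x v)) <= expW theta x / N - S.
    rewrite /e mulrAC ler_pdivrMr // mulrC [X in _ <= X]mulrC.
    by rewrite [expW theta x / N]mulrC mulrC.
  suff : e * (expW theta x / N - 1) <= e * (f (x u) - f (x v)) by lra.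
  by rewrite ler_pM2l //; lra.
have -> : a * (1 + q * (1 - e) / N) * expW theta x + a * q * e =
  a * (expW theta x + q * (expW theta x / N - e * (expW theta x / N - 1))).
  by field.
by rewrite ler_pM2l // lerD2l ler_pM2l.
Qed.

(** A globally minimal node lies in some neighborhood, so the minimizer served there with
    probability at least [eps] is global too, and serving it lowers the deficit. All other
    transitions contribute nonnegatively. *)
Lemma step_deficit eta x : 0 <= eta -> ~~ shape_zero R x ->
  exists2 d, deficit x = d.+1 &
    eps * eta ^+ d <= step (fun y => eta ^+ deficit y) x.
Proof.
move=> eta0 x0; have [v vmin] := exists_argmin x n_gt0.
have [i [j0 sv]] := cover v; have [_ _ _ /(_ x i)[j jle Pj]] := bal.
have jmin k : (x (s i j) <= x k)%N by rewrite (leq_trans (jle j0)) // sv.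
have [u ju] := shape_nonzero_lt n_gt0 _ _ x0 jmin.
have dE := deficit_incr_min _ _ _ jmin ju.
exists (deficit (incr n x (s i j))); first by rewrite dE.
have := @step_ge_term _ _ _ _ s _ _ lam_ge0 P_ge0
  (fun y => eta ^+ deficit y) x i j (fun y => exprn_ge0 _ eta0).
by apply: le_trans; apply: ler_wpM2r => //; exact: exprn_ge0.
Qed.

(* [expW] contracts where it is large. On its sublevel sets the deficit is
   bounded, and there the decrease of [1 - eta ^+ deficit], caused by the
   chance of serving a global minimum, absorbs the constant [b]. *)
Lemma lyapunov : exists (U : config n -> R) (gam : R),
  [/\ 0 < gam, gam < 1, forall x, 1 <= U x &
      forall x, ~~ shape_zero R x -> step U x <= gam * U x].
Proof.
have [theta [rho [b [t0 r0 r1 b0 drift]]]] := expW_drift.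
(* With this [eta], [eps * eta ^+ d] is [2 * eta ^+ d.+1]: from a nonzero shape the mean of
   [eta ^+ deficit] at least doubles in one step. *)
pose W (x : config n) : R := expW theta x; pose eta := eps / 2.
have eta0 : 0 < eta by rewrite divr_gt0.
have eta1 : eta <= 1 by rewrite ler_pdivrMr //; have := eps_lt1; lra.
(* Where W is at least [L], half of [(1 - rho) * W] absorbs [b]; below [L], [expW_ge] keeps the
   deficit under [D0]. *)
pose L := 2 * b / (1 - rho).
have L0 : 0 <= L by rewrite divr_ge0 ?mulr_ge0 // subr_ge0 ltW.
pose D0 := Num.bound (n%:R * L / theta).
(* On that sublevel set [delta] bounds the gain in [eta ^+ deficit] from below, and [A] scales it up
   to [b]. *)
pose delta := eta * eta ^+ D0.
have delta0 : 0 < delta by rewrite mulr_gt0 ?exprn_gt0.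
pose A := b / delta.
have A0 : 0 <= A by rewrite divr_ge0 // ltW.
(* As W is at least 1, the function U is at most (1 + A) W, so [c] times U costs at most half of
   [(1 - rho) * W]. *)
pose c : R := (1 - rho) / (2 * (1 + A)).
have cA : c * (1 + A) = (1 - rho) / 2 by rewrite /c; field; rewrite gt_eqF //; lra.
have c0 : 0 < c by rewrite divr_gt0 ?mulr_gt0 ?subr_gt0 //; lra.
have W1 x : 1 <= W x by apply: expW_ge1; rewrite ?ltW.
have pow1 x : eta ^+ deficit x <= 1 by rewrite exprn_ile1 // ltW.
exists (fun x => W x + A * (1 - eta ^+ deficit x)), (1 - c); split.
- by nra.
- lra.
- move=> x; have := W1 x; have := pow1 x; nra.
move=> x x0; have [d dE le_d] := step_deficit (ltW eta0) x0.
rewrite stepD stepZ stepB step_cst // dE exprS.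
have dr : step W x <= rho * W x + b := drift x.
set p := eta ^+ d in le_d *.
have p0 : 0 <= p by rewrite exprn_ge0 // ltW.
have epsE : eps = 2 * eta by rewrite /eta; lra.
rewrite epsE in le_d; set sd := step _ _ in le_d *.
have Wx1 := W1 x.
have Aep0 : 0 <= A * (eta * p) := mulr_ge0 A0 (mulr_ge0 (ltW eta0) p0).
have main : (1 - rho) / 2 * W x <= (1 - rho) * W x - b + A * (eta * p).
  have [WL|WL] := leP (2 * b) ((1 - rho) * W x).
    lra.
  have dD : (d <= D0)%N.
    have [u umax] := exists_argmax x n_gt0.
    have := expW_ge n_gt0 theta _ _ umax; rewrite -/(W x) dE => Wge.
    have WltL : W x < L by rewrite /L ltr_pdivlMr ?subr_gt0 // mulrC.
    have : d.+1%:R <= n%:R * L / theta.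
      rewrite ler_pdivlMr // mulrC -ler_pdivrMl // mulrC; lra.
    move=> dL; have := archi_boundP (le_trans (ler0n _ _) dL).
    by rewrite -/D0 => /(le_lt_trans dL); rewrite ltr_nat => /ltnW/ltnW.
  have : b <= A * (eta * p).
    have -> : b = A * delta by rewrite /A divfK // gt_eqF.
    by rewrite ler_wpM2l // ler_pM2l // ler_wiXn2l // ltW.
  have : 0 <= (1 - rho) * W x by rewrite mulr_ge0 // ?subr_ge0; lra.
  lra.
have cU : c * (W x + A * (1 - eta * p)) <= (1 - rho) / 2 * W x.
  rewrite -cA -[leRHS]mulrA; apply: ler_wpM2l; first exact: ltW.
  have : A <= A * W x by rewrite ler_peMr.
  lra.
have : A * (2 * eta * p) <= A * sd by rewrite ler_wpM2l.
lra.
Qed.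

End Drift.

(** * Positive recurrence and exponential moments *)

Theorem theorem2p1 (R : realType) (n K : nat) (kappa : 'I_K -> nat)
  (s : forall i : 'I_K, 'I_(kappa i) -> 'I_n) (lam : 'I_K -> R)
  (HK : (0 < K)%N)
  (Hkappa : forall i, (0 < kappa i)%N)
  (Hs_inj : forall i, injective (s i))
  (Hcover : forall l : 'I_n, exists i j, s i j = l)
  (Hlam_pos : forall i, 0 < lam i)
  (Hlam_sum : \sum_(i < K) lam i = 1)
  (Hconn : G_connected s)
  (Hsol : exists alpha, pos_solution s lam alpha)
  (P : policy R kappa)
  (HP : P = JSQ R s \/
        exists alpha eps, [/\ pos_solution s lam alpha, 0 < eps,
                              (forall i j, eps < alpha i j) &
                              P = PSERP s lam alpha eps]) :
  (forall x : config n, (Etau s lam P (fun m => m%:R) x < +oo)%E) /\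
  exists c : R, 0 < c /\
    forall c' : R, 0 < c' -> c' < c ->
      forall x : config n, (Etau s lam P (fun m => expR (c' * m%:R)) x < +oo)%E.
Proof.
have [alpha [eps [sol e0 ea bal]]] : exists alpha eps,
    [/\ pos_solution s lam alpha, 0 < eps, forall i j, eps < alpha i j &
        balanced s lam alpha eps P].
  case: HP => [->|[alpha [eps [sol e0 ea ->]]]].
    have [alpha sol] := Hsol; have [a0 _ _] := sol.
    have [eps e0 ea] := pos_lower_bound a0.
    by exists alpha, eps; split=> //; exact: JSQ_balanced.
  by exists alpha, eps; split=> //; exact: PSERP_balanced.
pose i0 := Ordinal HK; pose j0 := Ordinal (Hkappa i0).
have n_gt0 : (0 < n)%N by exact: leq_ltn_trans (leq0n _) (ltn_ord (s i0 j0)).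
have lam_ge0 i : 0 <= lam i by exact: ltW.
have e1 : eps < 1.
  apply: lt_le_trans (ea i0 j0) _; apply: le_trans (alpha_le_lam j0 sol) _.
  by rewrite -Hlam_sum (bigD1 i0) //= lerDl sumr_ge0.
have [U [gam [g0 g1 U1 drift]]] :=
  lyapunov n_gt0 Hcover Hconn Hlam_pos Hlam_sum sol e0 e1 bal.
have [P_ge0 P_sum _ _] := bal.
pose C x := 1 + step s lam P U x / gam.
have tail x m : surv s lam P m x <= C x * gam ^+ m.
  exact: surv_le_lyapunov.
have C0 x : 0 <= C x.
  rewrite addr_ge0 // divr_ge0 ?(ltW g0) //; apply: step_ge0 => // y.
  exact: le_trans ler01 (U1 y).
(* The moment bounds need [expR c * gam < 1], which makes [- ln gam] the threshold. *)
have small c : c < - ln gam -> expR c * gam < 1.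
  by move=> cg; rewrite -[X in _ * X](lnK g0) -expRD -expR0 ltr_expR; lra.
have ln0 : 0 < - ln gam by rewrite oppr_gt0 ln_lt0 // g0.
split=> [x|].
  apply: (Etau_nat_lt_pinfty lam_ge0 Hlam_sum P_ge0 P_sum g0 g1 (C0 x) (tail x)
    (c := - ln gam / 2)); first by lra.
  by apply: small; lra.
exists (- ln gam); split=> // c c0 /small cg x.
exact: (Etau_expR_lt_pinfty lam_ge0 Hlam_sum P_ge0 P_sum g0 g1 (C0 x) (tail x)).
Qed.
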